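(* For all $n\ge 3$, the paraboloid $$\Sigma=\{(x_1,\dots,x_n,\,x_1^2+\cdots+x_n^2):(x_1,\dots,x_n)\in\mathbb{R}^n\}\subset\mathbb{R}^{n+1},$$ with the Riemannian metric induced by the Euclidean metric of $\mathbb{R}^{n+1}$, is conformally flat.
   Context: A hypersurface $\Sigma\subset\mathbb{R}^{n+1}$ ($n\ge3$) with induced metric given in local coordinates by $G(x)=(g_{ij})$, with inverse $(g^{ij})$, is called conformally flat if: when $n=3$, the Cotton tensor vanishes, $C_{ijk}=0$ for all $i,j,k$; when $n\ge4$, the Weyl conformal curvature tensor vanishes, $W_{ijkl}=0$ for all $i,j,k,l$. Here (summation convention) $R_{ijkl}$ are the components $R_m(\partial_i,\partial_j,\partial_k,\partial_l)$ of the Riemann curvature tensor $R_m(X,Y,Z,W)=\langle\nabla_X\nabla_YZ-\nabla_Y\nabla_XZ-\nabla_{[X,Y]}Z,W\rangle$, $R_{ij}=g^{\mu\nu}R_{\mu ij\nu}$, $R=g^{ij}R_{ij}$, $$W_{ijkl}=R_{ijkl}+\frac{1}{n-2}(g_{ki}R_{jl}-g_{il}R_{jk}+g_{jl}R_{ik}-g_{jk}R_{il})+\frac{1}{(n-1)(n-2)}(g_{il}g_{jk}-g_{ki}g_{jl})R,$$ $$S_{ij}=\frac{1}{n-2}\Big(R_{ij}-\frac{R}{2(n-1)}g_{ij}\Big),\qquad C_{ijk}=\nabla_jS_{ik}-\nabla_kS_{ij},$$ with $\nabla_jS_{ik}=\frac{\partial S_{ik}}{\partial x_j}-S_{mk}\Gamma^m_{ij}-S_{im}\Gamma^m_{kj}$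 and $\Gamma^m_{ij}=\frac12g^{km}(\partial_ig_{kj}+\partial_jg_{ki}-\partial_kg_{ij})$. *)

(* Defs.v *)
From HB Require Import structures.
From mathcomp Require Import all_boot all_order all_algebra.
From mathcomp Require Import all_classical all_reals all_analysis.

Set Implicit Arguments.
Unset Strict Implicit.
Unset Printing Implicit Defensive.

Import Order.TTheory GRing.Theory Num.Theory.
Import numFieldNormedType.Exports.

Local Open Scope classical_set_scope.
Local Open Scope ring_scope.

Section Calculus.
Context {R : realType} {n : nat} {V : normedModType R}.
Implicit Types (f : 'rV[R]_n -> V) (U : set 'rV[R]_n).

Definition unit_vector (i : 'I_n) : 'rV[R]_n := delta_mx 0 i.

Definition partial (i : 'I_n) f (x : 'rV[R]_n) : V := 'D_(unit_vector i) f x.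

(* Class C^k on the open set U. Derivability is required separately because
   [partial] is total and has a junk value where the derivative fails to exist. *)
Fixpoint class_C (k : nat) U f : Prop :=
  (forall x, U x -> {for x, continuous f}) /\
  match k with
  | 0 => True
  | k'.+1 => forall i : 'I_n,
      (forall x, U x -> derivable f x (unit_vector i)) /\
      class_C k' U (partial i f)
  end.

Definition smooth_on U f : Prop := forall k, class_C k U f.

End Calculus.

Definition dotv {R : realType} {m : nat} (u v : 'rV[R]_m) : R :=
  \sum_(i < m) u 0 i * v 0 i.

(* Riemannian geometry in one coordinate system x_1, ..., x_n: a metric is a
   matrix-valued function G of the coordinates, and a vector field is
   represented by the row of its components in the frame of the partial_i. *)
Section Metric.
Context {R : realType} {n : nat}.
Variable G : 'rV[R]_n -> 'M[R]_n.
Implicit Types (i j k l m : 'I_n) (x : 'rV[R]_n).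
Implicit Types (X Y Z W : 'rV[R]_n -> 'rV[R]_n).

Definition g_ i j x : R := G x i j.
Definition ginv i j x : R := invmx (G x) i j.

(* Gamma^m_{ij} *)
Definition christoffel m i j x : R :=
  2^-1 * \sum_(k < n) ginv k m x *
    (partial i (g_ k j) x + partial j (g_ k i) x - partial k (g_ i j) x).

Definition metric_inner X Y x : R :=
  \sum_(i < n) \sum_(j < n) g_ i j x * X x 0 i * Y x 0 j.

(* Levi-Civita covariant derivative nabla_X Y *)
Definition nabla X Y x : 'rV[R]_n :=
  \row_(m < n) (\sum_(i < n) X x 0 i * partial i (fun y => Y y 0 m) x +
    \sum_(i < n) \sum_(j < n) christoffel m i j x * X x 0 i * Y x 0 j).

Definition lie_bracket X Y x : 'rV[R]_n :=
  \row_(m < n) \sum_(i < n) (X x 0 i * partial i (fun y => Y y 0 m) x -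
                             Y x 0 i * partial i (fun y => X y 0 m) x).

Definition riemann X Y Z W x : R :=
  metric_inner (fun y => nabla X (nabla Y Z) y - nabla Y (nabla X Z) y
                         - nabla (lie_bracket X Y) Z y) W x.

Definition coord_field i : 'rV[R]_n -> 'rV[R]_n := fun=> unit_vector i.

Definition Rm_ i j k l x : R :=
  riemann (coord_field i) (coord_field j) (coord_field k) (coord_field l) x.

Definition ricci i j x : R :=
  \sum_(mu < n) \sum_(nu < n) ginv mu nu x * Rm_ mu i j nu x.

Definition scalar_curvature x : R :=
  \sum_(i < n) \sum_(j < n) ginv i j x * ricci i j x.

Definition weyl i j k l x : R :=
  Rm_ i j k l x
  + (n%:R - 2)^-1 * (g_ k i x * ricci j l x - g_ i l x * ricci j k x
                     + g_ j l x * ricci i k x - g_ j k x * ricci i l x)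
  + ((n%:R - 1) * (n%:R - 2))^-1 *
      (g_ i l x * g_ j k x - g_ k i x * g_ j l x) * scalar_curvature x.

Definition schouten i j x : R :=
  (n%:R - 2)^-1 *
    (ricci i j x - scalar_curvature x / (2 * (n%:R - 1)) * g_ i j x).

(* nabla_j S_{ik} *)
Definition nabla_schouten j i k x : R :=
  partial j (schouten i k) x
  - \sum_(m < n) schouten m k x * christoffel m i j x
  - \sum_(m < n) schouten i m x * christoffel m k j x.

Definition cotton i j k x : R :=
  nabla_schouten j i k x - nabla_schouten k i j x.

Definition conformally_flat_metric_at x : Prop :=
  (n = 3%N -> forall i j k, cotton i j k x = 0) /\
  ((4 <= n)%N -> forall i j k l, weyl i j k l x = 0).

End Metric.

Section Hypersurface.
Context {R : realType} {n : nat}.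
Implicit Types (S : set 'rV[R]_(n + 1)) (U : set 'rV[R]_n)
  (phi : 'rV[R]_n -> 'rV[R]_(n + 1)).

Definition induced_metric phi (x : 'rV[R]_n) : 'M[R]_n :=
  \matrix_(i, j) dotv (partial i phi x) (partial j phi x).

(* phi : U -> S is a smooth regular parametrization of an open piece of S, i.e.
   phi^-1 is a system of local coordinates on S. The last clause says that phi
   is an open map from U into S with the subspace topology, so that, with
   injectivity and continuity, phi is a homeomorphism onto an open subset of S. *)
Definition local_parametrization S U phi : Prop :=
  [/\ open U,
      smooth_on U phi,
      forall x, U x -> row_free (\matrix_(i < n) partial i phi x),
      {in U &, injective phi} &
      forall V, open V -> V `<=` U ->
        exists2 O : set 'rV[R]_(n + 1), open O & phi @` V = S `&` O].

(* S is a smooth hypersurface, covered by local coordinates in which the Cotton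
   (n = 3) or Weyl (n >= 4) components of the induced metric vanish. These
   being tensors, the choice of local coordinates around a point is
   immaterial. *)
Definition conformally_flat S : Prop :=
  forall p, S p ->
    exists U phi, [/\ local_parametrization S U phi,
      (phi @` U) p &
      forall x, U x -> conformally_flat_metric_at (induced_metric phi) x].

End Hypersurface.

Definition paraboloid (R : realType) (n : nat) : set 'rV[R]_(n + 1) :=
  range (fun x : 'rV[R]_n => row_mx x (const_mx (\sum_(i < n) x 0 i ^+ 2))).

Arguments paraboloid : clear implicits.

(* Main.v *)
Require Import Defs.
From mathcomp Require Import all_boot all_order all_algebra.
From mathcomp Require Import all_classical all_reals all_analysis.
From mathcomp Require Import ring.

Set Implicit Arguments.
Unset Strict Implicit.
Unset Printing Implicit Defensive.

Import Order.TTheory GRing.Theory Num.Theory.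
Import numFieldNormedType.Exports.

Local Open Scope classical_set_scope.
Local Open Scope ring_scope.

(** The paraboloid is the graph of the function sum_i x_i^2, so the projection
to R^n is a global chart [pchart]: polynomial, hence smooth; an immersion; and a
homeomorphism onto the paraboloid since the projection is a continuous inverse
([local_parametrization_pchart]). The induced metric is
g_ij = delta_ij + 4 x_i x_j ([induced_metric_pchart]), a rank one perturbation
of the identity, and with D = 1 + 4 |x|^2 everything is explicit:
- the inverse metric is delta_ij - (4/D) x_i x_j ([ginv_pmetric]);
- Gamma^m_ij = (4/D) delta_ij x_m ([christoffel_pmetric]);
- R_ijkl = (4/D) (delta_jk delta_il - delta_ik delta_jl) ([Rm_pmetric]), which is
  Gauss's equation for the second fundamental form (2 / sqrt D) delta_ij;
- R_ij = (4/D) ((n-2) delta_ij + g_ij / D) ([ricci_pmetric]);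
- S_ij = (2/D) (delta_ij - 4 x_i x_j) ([schouten_pmetric]).

Weyl: the curvature is, up to the factor 2/D, the Kulkarni-Nomizu square of
delta, and delta = g - 4 x x^T. The square of the rank one form x x^T vanishes,
so the curvature is the Kulkarni-Nomizu product of g with a symmetric 2-tensor,
and the Weyl tensor of such a product is zero. With the formulas above this is a
rational identity in n, D, the delta_ij and the x_i ([weyl_pmetric]). For the
Cotton tensor, antisymmetrized in j and k, both the derivative terms and the
Christoffel terms are multiples of delta_ij x_k - delta_ik x_j, and the
coefficients cancel because D = 1 + 4 |x|^2 ([cotton_pmetric]). *)

(** * Derivatives of polynomial functions and quotients *)

Section Calculus.
Context {R : realType}.

(** A function which restricts to a polynomial of degree at most two on each line
of direction [v] has the linear coefficient as its derivative; all derivatives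
of polynomials below are read off in this way, vector-valued ones included. *)
Lemma is_derive_quadratic (V W : normedModType R) (f : V -> W) (a v : V)
    (A B : W) :
  (forall h : R, f (h *: v + a) = f a + h *: A + h ^+ 2 *: B) ->
  is_derive a v f A.
Proof.
move=> fE.
suff cvA : (fun h : R => h^-1 *: ((f \o shift a) (h *: v) - f a)) @ 0^' --> A.
  by apply: DeriveDef; [apply/cvg_ex; exists A | exact: cvg_lim].
have cvAB : (fun h : R => A + h *: B) @ 0^' --> A.
  rewrite -[X in _ --> X]addr0 -[X in _ + X](scale0r B).
  apply: cvgD; first exact: cvg_cst.
  by apply: cvgZr_tmp; apply: cvg_within.
apply: cvg_trans cvAB; apply: near_eq_cvg.
near=> h.
have h0 : h != 0 by near: h; exact: nbhs_dnbhs_neq.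
rewrite /= fE -(addrA (f a)) addrAC subrr add0r scalerDr !scalerA mulVf //.
by rewrite scale1r expr2 mulrA mulVf // mul1r.
Unshelve. all: by end_near. Qed.

Lemma is_derive_quotient (V : normedModType R) (p q : V -> R) (a v : V)
    (dp dq : R) :
  q a != 0 -> is_derive a v p dp -> is_derive a v q dq ->
  is_derive a v (fun y => p y / q y) (dp / q a - p a * dq / q a ^+ 2).
Proof.
move=> q0 hp hq.
have hqV : is_derive a v (fun y => (q y)^-1) (- (q a) ^- 2 *: dq).
  apply: DeriveDef; first by apply: derivableV => //; case: hq.
  by rewrite deriveV ?derive_val //; case: hq.
apply: (@is_derive_eq _ _ _ (p * (fun y => (q y)^-1)) _ _ _ _
  (is_deriveM hp hqV)).
by rewrite /GRing.scale /=; field.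
Qed.

Lemma continuous_mx (T : topologicalType) (m n : nat) (M : T -> 'M[R]_(m, n))
    (t : T) :
  (forall i j, {for t, continuous (fun s => M s i j)}) -> {for t, continuous M}.
Proof.
move=> Mc; apply/cvg_ballP => e e0.
have : \forall s \near t, forall ij : 'I_m * 'I_n,
    ball (M t ij.1 ij.2) e (M s ij.1 ij.2).
  apply: filter_forall => ij; have /cvg_ballP := Mc ij.1 ij.2; exact.
by apply: filterS => s h; split=> // i j; exact: h (i, j).
Qed.

End Calculus.

(** * Coordinate functions and the Kronecker symbol *)

Section Coordinates.
Context {R : realType} {n : nat}.
Implicit Types (i j k l m : 'I_n) (x : 'rV[R]_n).

(** The Kronecker symbol, as a real number. *)
Definition kron i j : R := (i == j)%:R.

Lemma kronC i j : kron i j = kron j i.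
Proof. by rewrite /kron eq_sym. Qed.

Lemma sum_kronl i (F : 'I_n -> R) : \sum_j kron i j * F j = F i.
Proof.
rewrite (bigD1 i) //= big1 ?addr0 /kron ?eqxx ?mul1r // => j ji.
by rewrite eq_sym (negbTE ji) mul0r.
Qed.

Lemma sum_kronr i (F : 'I_n -> R) : \sum_j F j * kron j i = F i.
Proof.
by rewrite -[RHS]sum_kronl; apply: eq_bigr => j _; rewrite mulrC kronC.
Qed.

Lemma unit_vectorE i j : unit_vector i 0 j = kron i j :> R.
Proof. by rewrite /unit_vector /kron mxE eqxx eq_sym. Qed.

(** The square of the Euclidean norm. *)
Definition sqnorm x : R := \sum_(k < n) x 0 k ^+ 2.

Lemma sqnorm_shift (h : R) i x :
  sqnorm (h *: unit_vector i + x) = sqnorm x + h * (2 * x 0 i) + h ^+ 2.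
Proof.
transitivity (\sum_k (x 0 k ^+ 2 + kron i k * (h * (2 * x 0 k))
    + kron i k * h ^+ 2)).
  apply: eq_bigr => k _; rewrite !mxE -/(unit_vector i).
  by rewrite eqxx eq_sym /kron /=; case: eqP => _ /=; ring.
by rewrite !big_split /= !sum_kronl.
Qed.

Lemma coord_shift (h : R) i x k :
  (h *: unit_vector i + x) 0 k = x 0 k + h * kron i k.
Proof. by rewrite mxE addrC mxE unit_vectorE. Qed.

Lemma partial_cst (V : normedModType R) i (c : V) x :
  partial i (fun=> c) x = 0.
Proof. exact: derive_cst. Qed.

Lemma class_C_cst (V : normedModType R) (k : nat) (U : set 'rV[R]_n) (c : V) :
  class_C k U (fun=> c).
Proof.
have cc x : U x -> {for x, continuous (fun=> c : V)}.
  by move=> _; exact: cst_continuous.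
elim: k => [|k IH] in c cc *; split=> // i; split=> [x _|].
  exact: derivable_cst.
rewrite (_ : partial i _ = fun=> 0); last first.
  by apply/funext => x; exact: partial_cst.
by apply: IH => x _; exact: cst_continuous.
Qed.

End Coordinates.

(** * Curvature in a coordinate frame *)

Section Curvature.
Context {R : realType} {n : nat}.
Variable G : 'rV[R]_n -> 'M[R]_n.
Implicit Types (i j k l m : 'I_n) (x : 'rV[R]_n).
Local Notation "'Gam" := (christoffel G).

Lemma nabla_coordl i (Y : 'rV[R]_n -> 'rV[R]_n) x :
  nabla G (coord_field i) Y x = \row_m (partial i (fun y => Y y 0 m) x +
     \sum_p 'Gam m i p x * Y x 0 p).
Proof.
apply/rowP => m; rewrite !mxE; congr (_ + _).
  under eq_bigr do rewrite unit_vectorE.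
  by rewrite sum_kronl.
under eq_bigr => a _ do under eq_bigr => b _ do
  rewrite unit_vectorE [_ * kron _ _]mulrC -mulrA.
under eq_bigr => a _ do rewrite -mulr_sumr.
by rewrite sum_kronl.
Qed.

Lemma nabla_coord i j x :
  nabla G (coord_field i) (coord_field j) x = \row_m 'Gam m i j x.
Proof.
rewrite nabla_coordl; apply/rowP => m; rewrite !mxE partial_cst add0r.
by under eq_bigr do rewrite unit_vectorE kronC; rewrite sum_kronr.
Qed.

Lemma nabla_zerol (X Y : 'rV[R]_n -> 'rV[R]_n) x :
  X x = 0 -> nabla G X Y x = 0.
Proof.
move=> X0; apply/rowP => m; rewrite !mxE X0.
rewrite big1 ?add0r => [|i _]; last by rewrite mxE mul0r.
by apply: big1 => i _; apply: big1 => j _; rewrite mxE mulr0 mul0r.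
Qed.

Lemma lie_bracket_coord i j x :
  lie_bracket (coord_field i) (coord_field j) x = 0 :> 'rV[R]_n.
Proof.
apply/rowP => m; rewrite mxE [RHS]mxE; apply: big1 => k _.
by rewrite !partial_cst !mulr0 subrr.
Qed.

(** The classical coordinate expression of the curvature tensor; the bracket
term disappears because coordinate fields commute. *)
Lemma Rm_coord i j k l x :
  Rm_ G i j k l x = \sum_m g_ G m l x *
    ((partial i ('Gam m j k) x + \sum_p 'Gam m i p x * 'Gam p j k x) -
     (partial j ('Gam m i k) x + \sum_p 'Gam m j p x * 'Gam p i k x)).
Proof.
have nab2 a b :
    nabla G (coord_field a) (nabla G (coord_field b) (coord_field k)) x =
    \row_m (partial a ('Gam m b k) x + \sum_p 'Gam m a p x * 'Gam p b k x).
  rewrite nabla_coordl; apply/rowP => m; rewrite !mxE; congr (_ + _).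
    by congr (partial a _ x); apply/funext => y; rewrite nabla_coord mxE.
  by apply: eq_bigr => p _; rewrite nabla_coord mxE.
rewrite /Rm_ /riemann /metric_inner; apply: eq_bigr => m _.
under eq_bigr do rewrite unit_vectorE kronC.
rewrite sum_kronr !nab2 nabla_zerol; last exact: lie_bracket_coord.
by rewrite !mxE subr0.
Qed.

End Curvature.

(** * The metric of the paraboloid and its curvature *)

Section ParaboloidMetric.
Context {R : realType} {n : nat}.
Implicit Types (i j k l m : 'I_n) (x : 'rV[R]_n).

(** The metric I + 4 x^T x, for a row vector x. *)
Definition pmetric x : 'M[R]_n := \matrix_(i, j) (kron i j + 4 * x 0 i * x 0 j).

(** The determinant of [pmetric x]; only its role as the eigenvalue of
[pmetric x] in the direction of x is used. *)
Definition pdet x : R := 1 + 4 * sqnorm x.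

Lemma pdet_neq0 x : pdet x != 0.
Proof.
by rewrite gt_eqF // ltr_wpDr // mulr_ge0 // sumr_ge0 // => k _; exact: sqr_ge0.
Qed.

Lemma g_pmetric i j : g_ pmetric i j = fun x => kron i j + 4 * x 0 i * x 0 j.
Proof. by apply/funext => x; rewrite /g_ mxE. Qed.

Lemma mul_pmetric_inv x : pmetric x *m
  (\matrix_(i, j) (kron i j - 4 / pdet x * x 0 i * x 0 j)) = 1%:M.
Proof.
apply/matrixP => i j; rewrite !mxE -/(kron i j).
transitivity (\sum_k (kron i k * kron k j
    - kron i k * (4 / pdet x * x 0 k * x 0 j)
    + (4 * x 0 i * x 0 k) * kron k j
    - x 0 k ^+ 2 * (16 / pdet x * x 0 i * x 0 j))).
  by apply: eq_bigr => k _; rewrite !mxE; ring.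
rewrite sumrB big_split /= sumrB !sum_kronl sum_kronr -mulr_suml -/(sqnorm x).
by have := pdet_neq0 x; rewrite /pdet => D0; field.
Qed.

Lemma pmetric_unit x : pmetric x \in unitmx.
Proof. by case: (mulmx1_unit (mul_pmetric_inv x)). Qed.

Lemma ginv_pmetric i j x :
  ginv pmetric i j x = kron i j - 4 / pdet x * x 0 i * x 0 j.
Proof.
rewrite /ginv -[invmx _]mulmx1 -(mul_pmetric_inv x) mulmxA.
by rewrite (mulVmx (pmetric_unit x)) mul1mx mxE.
Qed.

(** The metric multiplies the vector x by [pdet x], and its inverse divides x by
[pdet x]. *)
Lemma sum_g_pmetric l x : \sum_m g_ pmetric m l x * x 0 m = pdet x * x 0 l.
Proof.
transitivity (\sum_m (x 0 m * kron m l + x 0 m ^+ 2 * (4 * x 0 l))).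
  by apply: eq_bigr => m _; rewrite g_pmetric; ring.
by rewrite big_split /= sum_kronr -mulr_suml -/(sqnorm x) /pdet; ring.
Qed.

Lemma sum_ginv_pmetric m x : \sum_k ginv pmetric k m x * x 0 k = x 0 m / pdet x.
Proof.
transitivity (\sum_k (x 0 k * kron k m - x 0 k ^+ 2 * (4 / pdet x * x 0 m))).
  by apply: eq_bigr => k _; rewrite ginv_pmetric; ring.
rewrite sumrB sum_kronr -mulr_suml -/(sqnorm x).
by have := pdet_neq0 x; rewrite /pdet => D0; field.
Qed.

Lemma partial_g_pmetric l i j x : partial l (g_ pmetric i j) x =
  4 * (kron l i * x 0 j + x 0 i * kron l j).
Proof.
rewrite g_pmetric; apply: derive_val; apply: (@is_derive_quadratic _ _ _ _ _ _ _
  (4 * kron l i * kron l j : R)) => h.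
by rewrite !coord_shift /GRing.scale /=; ring.
Qed.

Lemma christoffel_pmetric m i j :
  christoffel pmetric m i j = fun x => 4 * kron i j * x 0 m / pdet x.
Proof.
apply/funext => x; rewrite /christoffel.
transitivity (2^-1 * \sum_k (ginv pmetric k m x * x 0 k) * (8 * kron i j)).
  congr (_ * _); apply: eq_bigr => k _; rewrite !partial_g_pmetric.
  by rewrite (kronC j i) (kronC j k) (kronC i k); ring.
rewrite -mulr_suml sum_ginv_pmetric.
by have D0 := pdet_neq0 x; field.
Qed.

Lemma is_derive_pdet x i : is_derive x (unit_vector i) pdet (8 * x 0 i).
Proof.
apply: (@is_derive_quadratic _ _ _ _ _ _ _ (4 : R)) => h.
by rewrite /pdet sqnorm_shift /GRing.scale /=; ring.
Qed.

Lemma partial_christoffel_pmetric l m i j x :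
  partial l (christoffel pmetric m i j) x =
  4 * kron i j * (kron l m / pdet x - 8 * x 0 l * x 0 m / pdet x ^+ 2).
Proof.
have D0 := pdet_neq0 x.
have dp : is_derive x (unit_vector l) (fun y => 4 * kron i j * y 0 m)
    (4 * kron i j * kron l m).
  apply: (@is_derive_quadratic _ _ _ _ _ _ _ 0) => h.
  by rewrite coord_shift /GRing.scale /=; ring.
have := is_derive_quotient D0 dp (is_derive_pdet x l).
by rewrite christoffel_pmetric /partial => /@derive_val ->; field.
Qed.

Lemma Rm_pmetric i j k l x : Rm_ pmetric i j k l x =
  4 / pdet x * (kron j k * kron i l - kron i k * kron j l).
Proof.
have D0 := pdet_neq0 x.
have sumG a b m : \sum_p christoffel pmetric m a p x * christoffel pmetric p b k x
   = 16 * kron b k * x 0 a * x 0 m / pdet x ^+ 2.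
  transitivity (\sum_p kron a p * (16 * kron b k * x 0 p * x 0 m / pdet x ^+ 2)).
    by apply: eq_bigr => p _; rewrite !christoffel_pmetric; field.
  by rewrite sum_kronl.
rewrite Rm_coord.
transitivity (\sum_m ((kron i m * g_ pmetric m l x) * (4 * kron j k / pdet x)
  - (kron j m * g_ pmetric m l x) * (4 * kron i k / pdet x)
  + (g_ pmetric m l x * x 0 m) *
    (16 * (kron i k * x 0 j - kron j k * x 0 i) / pdet x ^+ 2))).
  by apply: eq_bigr => m _; rewrite !partial_christoffel_pmetric !sumG; field.
rewrite big_split /= sumrB -!mulr_suml !sum_kronl sum_g_pmetric !g_pmetric.
by field.
Qed.

Lemma tr_ginv_pmetric x :
  \sum_i ginv pmetric i i x = n%:R - 1 + (pdet x)^-1.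
Proof.
transitivity (\sum_i ((1 : R) - x 0 i ^+ 2 * (4 / pdet x))).
  by apply: eq_bigr => i _; rewrite ginv_pmetric /kron eqxx mulr1n; ring.
rewrite sumrB -mulr_suml -/(sqnorm x) sumr_const card_ord.
by have := pdet_neq0 x; rewrite /pdet => D0; field.
Qed.

Lemma ricci_pmetric i j x : ricci pmetric i j x =
  4 / pdet x * ((n%:R - 2) * kron i j + g_ pmetric i j x / pdet x).
Proof.
rewrite /ricci.
transitivity (\sum_mu 4 / pdet x * (kron i j * ginv pmetric mu mu x
    - kron j mu * ginv pmetric mu i x)).
  apply: eq_bigr => mu _.
  transitivity (\sum_nu
      (kron mu nu * (4 / pdet x * kron i j * ginv pmetric mu nu x)
     - kron i nu * (4 / pdet x * kron j mu * ginv pmetric mu nu x))).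
    by apply: eq_bigr => nu _; rewrite Rm_pmetric (kronC j mu); ring.
  by rewrite sumrB !sum_kronl; ring.
rewrite -mulr_sumr sumrB -mulr_sumr sum_kronl tr_ginv_pmetric.
rewrite ginv_pmetric g_pmetric (kronC j i).
by have D0 := pdet_neq0 x; field.
Qed.

(** Contraction of [ricci_pmetric], using tr (g^-1 g) = n. *)
Lemma scalar_curvature_pmetric x : scalar_curvature pmetric x =
  4 * (n%:R - 1) / pdet x * (n%:R - 2 + 2 / pdet x).
Proof.
have D0 := pdet_neq0 x.
have ginvg i : \sum_j ginv pmetric i j x * g_ pmetric j i x = 1.
  transitivity ((invmx (pmetric x) *m pmetric x) i i); first by rewrite mxE.
  by rewrite (mulVmx (pmetric_unit x)) mxE eqxx.
rewrite /scalar_curvature.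
transitivity (\sum_i ((4 / pdet x * (n%:R - 2)) * ginv pmetric i i x
    + 4 / pdet x ^+ 2)).
  apply: eq_bigr => i _.
  transitivity (\sum_j (kron i j * (4 / pdet x * (n%:R - 2) * ginv pmetric i j x)
    + 4 / pdet x ^+ 2 * (ginv pmetric i j x * g_ pmetric j i x))).
    apply: eq_bigr => j _; rewrite ricci_pmetric !g_pmetric (kronC j i).
    by field.
  by rewrite big_split /= sum_kronl -mulr_sumr ginvg mulr1.
rewrite big_split /= -mulr_sumr tr_ginv_pmetric sumr_const card_ord.
by rewrite -mulr_natr; field.
Qed.

Lemma dim_neq0 : (3 <= n)%N ->
  n%:R - 1 != 0 :> R /\ n%:R - 2 != 0 :> R.
Proof.
by case: n => [|[|[|p]]] // _; rewrite !subr_eq0 (eqr_nat R _ 1) (eqr_nat R _ 2).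
Qed.

Lemma weyl_pmetric i j k l x : (3 <= n)%N -> weyl pmetric i j k l x = 0.
Proof.
move=> n3; have D0 := pdet_neq0 x.
have [n1 n2] := dim_neq0 n3.
rewrite /weyl Rm_pmetric !ricci_pmetric scalar_curvature_pmetric !g_pmetric.
rewrite (kronC k i); field.
by rewrite D0 n1 n2.
Qed.

Lemma schouten_pmetric i k : (3 <= n)%N -> schouten pmetric i k =
  fun x => (2 * kron i k - 8 * x 0 i * x 0 k) / pdet x.
Proof.
move=> n3; apply/funext => x; have D0 := pdet_neq0 x.
have [n1 n2] := dim_neq0 n3.
rewrite /schouten ricci_pmetric scalar_curvature_pmetric !g_pmetric; field.
by rewrite D0 n1 n2.
Qed.

Lemma partial_schouten_pmetric j i k x : (3 <= n)%N ->
  partial j (schouten pmetric i k) x =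
  - 8 * (kron j i * x 0 k + x 0 i * kron j k) / pdet x
  - (2 * kron i k - 8 * x 0 i * x 0 k) * (8 * x 0 j) / pdet x ^+ 2.
Proof.
move=> n3; have D0 := pdet_neq0 x.
have dp : is_derive x (unit_vector j)
    (fun y : 'rV[R]_n => 2 * kron i k - 8 * y 0 i * y 0 k)
    (- 8 * (kron j i * x 0 k + x 0 i * kron j k)).
  apply: (@is_derive_quadratic _ _ _ _ _ _ _
    (- 8 * kron j i * kron j k : R)) => h.
  by rewrite !coord_shift /GRing.scale /=; ring.
have := is_derive_quotient D0 dp (is_derive_pdet x j).
by rewrite schouten_pmetric // /partial => /@derive_val ->; field.
Qed.

Lemma cotton_pmetric i j k x : (3 <= n)%N -> cotton pmetric i j k x = 0.
Proof.
move=> n3; have D0 := pdet_neq0 x.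
have SG a b c : \sum_m schouten pmetric m a x * christoffel pmetric m b c x =
    8 * kron b c * (x 0 a * (1 - 4 * sqnorm x)) / pdet x ^+ 2.
  transitivity (\sum_m ((x 0 m * kron m a) * (8 * kron b c / pdet x ^+ 2)
      - x 0 m ^+ 2 * (32 * kron b c * x 0 a / pdet x ^+ 2))).
    by apply: eq_bigr => m _; rewrite schouten_pmetric //
      christoffel_pmetric; field.
  by rewrite sumrB -!mulr_suml sum_kronr -/(sqnorm x); field.
rewrite /cotton /nabla_schouten (SG k i j) (SG j i k).
rewrite (partial_schouten_pmetric j i k x n3).
rewrite (partial_schouten_pmetric k i j x n3).
(* The other Christoffel terms are exchanged by swapping j and k, and cancel. *)
have -> : \sum_m schouten pmetric i m x * christoffel pmetric m j k x =
  \sum_m schouten pmetric i m x * christoffel pmetric m k j x.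
  by apply: eq_bigr => m _; rewrite !christoffel_pmetric (kronC j k).
rewrite (kronC j i) (kronC k i) (kronC k j).
by rewrite /pdet in D0 *; field.
Qed.

End ParaboloidMetric.

(** * The global chart of the paraboloid *)

Section Graph.
Context {R : realType} {n : nat}.
Implicit Types (i j k : 'I_n) (x : 'rV[R]_n).

(** The inverse of the projection of the paraboloid to R^n. *)
Definition pchart x : 'rV[R]_(n + 1) := row_mx x (const_mx (sqnorm x)).

Lemma is_derive_pchart i x : is_derive x (unit_vector i) pchart
  (row_mx (unit_vector i) (const_mx (2 * x 0 i))).
Proof.
apply: (@is_derive_quadratic _ _ _ _ _ _ _ (row_mx 0 (const_mx 1))) => h.
rewrite /pchart sqnorm_shift !scale_row_mx !add_row_mx scaler0 addr0.
by congr row_mx; [rewrite addrC | apply/rowP => a; rewrite !mxE mulr1].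
Qed.

Lemma partial_pchart i : partial i pchart =
  fun x => row_mx (unit_vector i) (const_mx (2 * x 0 i)).
Proof. by apply/funext => x; case: (is_derive_pchart i x). Qed.

Lemma is_derive_partial_pchart i j x :
  is_derive x (unit_vector j) (partial i pchart)
    (row_mx 0 (const_mx (2 * kron j i))).
Proof.
rewrite partial_pchart; apply: (@is_derive_quadratic _ _ _ _ _ _ _ 0) => h.
rewrite scaler0 addr0 coord_shift scale_row_mx add_row_mx scaler0 addr0.
by congr row_mx; apply/rowP => a; rewrite !mxE; ring.
Qed.

Lemma partial_partial_pchart i j : partial j (partial i pchart) =
  fun=> row_mx 0 (const_mx (2 * kron j i)).
Proof. by apply/funext => x; case: (is_derive_partial_pchart i j x). Qed.

Lemma continuous_row_mx_const (T : topologicalType) (m : nat)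
    (u : T -> 'rV[R]_m) (q : T -> R) :
  continuous u -> continuous q ->
  continuous (fun t => row_mx (u t) (const_mx (q t)) : 'rV[R]_(m + 1)).
Proof.
move=> uc qc t; apply: continuous_mx => i j.
case: (split_ordP j) => a ->.
  rewrite (_ : (fun s => _) = fun s => u s i a); last first.
    by apply/funext => s; rewrite row_mxEl.
  apply: (@continuous_comp _ _ _ u (fun w : 'rV[R]_m => w i a)).
    exact: uc.
  exact: coord_continuous.
rewrite (_ : (fun s => _) = q); first exact: qc.
by apply/funext => s; rewrite row_mxEr mxE.
Qed.

Lemma continuous_sqnorm : continuous (sqnorm : 'rV[R]_n -> R).
Proof.
apply: (continuous_big add_continuous) => k _ x.
apply: (@continuous_comp _ _ _ (fun y : 'rV[R]_n => y 0 k) (fun r : R => r ^+ 2)).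
  exact: coord_continuous.
exact: exprn_continuous.
Qed.

Lemma smooth_pchart : smooth_on setT pchart.
Proof.
have c0 x : setT x -> {for x, continuous pchart}.
  by move=> _; move: x; apply: continuous_row_mx_const => x;
    [exact: cvg_id | exact: continuous_sqnorm].
have c1 i x : setT x -> {for x, continuous (partial i pchart)}.
  move=> _; move: x; rewrite partial_pchart; apply: continuous_row_mx_const => x.
    exact: cst_continuous.
  apply: (@continuous_comp _ _ _ (fun y : 'rV[R]_n => y 0 i) ( *%R 2)).
    exact: coord_continuous.
  exact: mulrl_continuous.
(* The second derivatives are constant, so that class C^k is reached after two
   unfoldings for every k. *)
case=> [|k]; split=> // i; split=> [x _|]; first by case: (is_derive_pchart i x).
case: k => [|k]; split=> //; try exact: c1 i; move=> j.
split=> [x _|]; first by case: (is_derive_partial_pchart i j x).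
by rewrite partial_partial_pchart; exact: class_C_cst.
Qed.

Lemma row_free_pchart x : row_free (\matrix_(i < n) partial i pchart x).
Proof.
apply/row_freeP; exists (col_mx 1%:M 0); apply/row_matrixP => i.
rewrite row_mul rowK partial_pchart mul_row_col mulmx1 mulmx0 addr0.
by rewrite row1.
Qed.

Lemma continuous_lsubmx (m p : nat) :
  continuous (lsubmx : 'rV[R]_(m + p) -> 'rV[R]_m).
Proof.
move=> v; apply: continuous_mx => i j.
rewrite (_ : (fun s => _) = fun s : 'rV[R]_(m + p) => s i (lshift p j)).
  exact: coord_continuous.
by apply/funext => s; rewrite mxE.
Qed.

Lemma local_parametrization_pchart :
  local_parametrization (paraboloid R n) setT pchart.
Proof.
split=> [||x _|x y _ _ /eq_row_mx[]//|V Vopen _]; first exact: openT.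
- exact: smooth_pchart.
- exact: row_free_pchart.
exists (lsubmx @^-1` V).
  by move/continuousP: (@continuous_lsubmx n 1); exact.
apply/seteqP; split=> [_ [x Vx <-]|p [[x _ <-]]] /=.
  by split; [exists x | rewrite row_mxKl].
by rewrite row_mxKl => Vx; exists x.
Qed.

Lemma induced_metric_pchart : induced_metric pchart = pmetric.
Proof.
apply/funext => x; apply/matrixP => i j; rewrite !mxE /dotv !partial_pchart.
rewrite big_split_ord /= big_ord1 !row_mxEr !mxE.
under eq_bigr do rewrite !row_mxEl !unit_vectorE.
by rewrite sum_kronl kronC; ring.
Qed.

End Graph.

Theorem mainTheorem5 (R : realType) (n : nat) (hn : (3 <= n)%N) :
  conformally_flat (paraboloid R n).
Proof.
move=> _ [x _ <-]; exists setT, pchart; split.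
- exact: local_parametrization_pchart.
- by exists x.
move=> y _; rewrite induced_metric_pchart; split=> _ *.
- exact: cotton_pmetric.
- exact: weyl_pmetric.
Qed.
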